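(* Let $n\ge 1$, let $a>0$, $b>0$ be constants, and let $f:\mathbb{R}^n\times[0,\infty)\to\mathbb{R}$ be a positive traveling wave solution of $$f_t=\Delta f+af-bf^3,$$ that is, a positive solution of the form $f(x,t)=v(x_1,x_2,\dots,x_n+\eta t)$ for some function $v:\mathbb{R}^n\to\mathbb{R}$ and some constant $\eta\in\mathbb{R}$. Suppose that $v\to 0$ along some way of going to infinity, i.e. there exists a sequence $(z_k)$ in $\mathbb{R}^n$ with $|z_k|\to\infty$ and $v(z_k)\to 0$. Then $$\eta^2\ \ge\ \frac43\,a .$$
   Context: The equation $f_t=\Delta f+af-bf^3$ is the Newell-Whitehead equation; $\Delta$ is the Laplacian in the space variable $x=(x_1,\dots,x_n)\in\mathbb{R}^n$. The constant $\eta$ is called the wavespeed. ''Solution'' means a classical solution. *)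

(* Defs.v *)
From HB Require Import structures.
From mathcomp Require Import all_boot all_order all_algebra.
From mathcomp Require Import all_classical all_reals all_analysis.

Set Implicit Arguments.
Unset Strict Implicit.
Unset Printing Implicit Defensive.

Import Order.TTheory GRing.Theory Num.Theory.
Import numFieldNormedType.Exports.

Local Open Scope classical_set_scope.
Local Open Scope ring_scope.

(* The library's norm on ['rV[R]_n] is the sup norm. *)
Definition euclidean_norm (R : realType) (n : nat) (x : 'rV[R]_n) : R :=
  Num.sqrt (\sum_(i < n) x 0 i ^+ 2).

(* Functions of (x, t) are total on R^n x R, and are only constrained on
   t >= 0; derivatives are only ever taken at t > 0.  The dimension is n.+1,
   and the coordinates x_1, ..., x_n of the text are indexed by 'I_n.+1, so
   that the last one has index ord_max. *)

Definition basis_vector (R : realType) (n : nat) (i : 'I_n.+1) : 'rV[R]_n.+1 :=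
  delta_mx 0 i.

Definition partial_x (R : realType) (n : nat) (i : 'I_n.+1)
    (f : 'rV[R]_n.+1 * R -> R) (p : 'rV[R]_n.+1 * R) : R :=
  'D_(basis_vector R i) (fun y => f (y, p.2)) p.1.

Definition partial_t (R : realType) (n : nat)
    (f : 'rV[R]_n.+1 * R -> R) (p : 'rV[R]_n.+1 * R) : R :=
  derive1 (fun s : R => f (p.1, s)) p.2.

Definition laplacian_x (R : realType) (n : nat)
    (f : 'rV[R]_n.+1 * R -> R) (p : 'rV[R]_n.+1 * R) : R :=
  \sum_(i < n.+1) partial_x i (partial_x i f) p.

Definition derivable_x (R : realType) (n : nat) (i : 'I_n.+1)
    (f : 'rV[R]_n.+1 * R -> R) (p : 'rV[R]_n.+1 * R) : Prop :=
  derivable (fun y => f (y, p.2)) p.1 (basis_vector R i).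

Definition derivable_t (R : realType) (n : nat)
    (f : 'rV[R]_n.+1 * R -> R) (p : 'rV[R]_n.+1 * R) : Prop :=
  derivable (fun s => f (p.1, s)) p.2 1.

(* C^2 in x and C^1 in t on the open set t > 0, with all these derivatives
   jointly continuous there. *)
Definition C21 (R : realType) (n : nat) (f : 'rV[R]_n.+1 * R -> R) : Prop :=
  forall p : 'rV[R]_n.+1 * R, 0 < p.2 ->
    [/\ derivable_t f p /\ {for p, continuous (partial_t f)},
        forall i, derivable_x i f p /\ {for p, continuous (partial_x i f)}
      & forall i j, derivable_x j (partial_x i f) p /\
          {for p, continuous (partial_x j (partial_x i f))}].

Definition newell_whitehead_solution (R : realType) (n : nat) (a b : R)
    (f : 'rV[R]_n.+1 * R -> R) : Prop :=
  [/\ {within [set p | 0 <= p.2], continuous f},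
      C21 f
    & forall p : 'rV[R]_n.+1 * R, 0 < p.2 ->
        partial_t f p = laplacian_x f p + a * f p - b * f p ^+ 3].

Definition traveling_wave (R : realType) (n : nat)
    (f : 'rV[R]_n.+1 * R -> R) (v : 'rV[R]_n.+1 -> R) (eta : R) : Prop :=
  forall (x : 'rV[R]_n.+1) (t : R), 0 <= t ->
    f (x, t) = v (x + (eta * t) *: basis_vector R ord_max).

(* Main.v *)
Require Import Defs.
From HB Require Import structures.
From mathcomp Require Import all_boot all_order all_algebra.
From mathcomp Require Import all_classical all_reals all_analysis.
From mathcomp Require Import ring lra.

Set Implicit Arguments.
Unset Strict Implicit.
Unset Printing Implicit Defensive.

Import Order.TTheory GRing.Theory Num.Theory.
Import numFieldNormedType.Exports.

Local Open Scope classical_set_scope.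
Local Open Scope ring_scope.

(** The bound comes from comparing the wave with a compactly supported
subsolution, as for the minimal speed of KPP fronts, and it gives the sharper
estimate 4 a <= eta^2.

At a fixed time the wave is, up to translation, its profile u > 0, which solves
the elliptic equation eta d_n u = Delta u + a u - b u^3.  Writing
u = exp (eta x_n / 2) w removes the drift and turns the linear part into
Delta w + (a - eta^2/4) w.  Suppose that mu := a - eta^2/4 is positive.  On a
large enough box the first Dirichlet eigenvalue of the Laplacian, which the
product of the cosines cos (k x_i) realizes, is only mu/2; multiplying that
product by exp (eta x_n / 2) gives [barrier].  Centre the barrier at any point
x and enlarge its multiple below u until it touches u, that is, take a maximum
point y of barrier / u over the box.  The barrier vanishes on the boundary of
the box and u does not, so y is an interior point, where the second derivative
test ([barrier_touching_ineq]) compares the Laplacians.  The linear parts then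
leave a surplus mu/2 u(y) that only the cubic term can absorb, hence
b u(y)^2 >= mu/2.  As the barrier is 1 at its centre and bounded by a constant M
independent of x, this yields u(x) >= u(y) / M >= sqrt (mu / (2 b)) / M for
every x ([stationary_lower_bound]), and u cannot tend to 0 along any
sequence. *)

(** * One-variable calculus *)

(** Only differentiability of [F1] at [c] itself is available, so the second
order condition is read off the sign of [F1] to the right of [c]: were [d2]
negative, [F] would decrease there by the mean value theorem. *)
Lemma second_derivative_test (R : realType) (F F1 : R -> R) (c d2 : R) :
  (\forall h \near c, is_derive h (1:R) F (F1 h)) ->
  is_derive c (1:R) F1 d2 ->
  (\forall h \near c, F c <= F h) ->
  F1 c = 0 /\ 0 <= d2.
Proof.
move=> dF dF1 minF.
have [e /= e0 He] : exists2 e, 0 < e & forall h, `|c - h| < e ->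
    is_derive h (1:R) F (F1 h) /\ F c <= F h.
  have := filterI dF minF; case=> e /= e0 He; exists e => [//|h ch].
  by have [] := He h ch.
have ballE h : h \in `]c - e, c + e[ -> `|c - h| < e.
  by rewrite in_itv /= ltr_distlC.
have F1c : F1 c = 0.
  have dc : is_derive c (1:R) F 0.
    apply: (@derive1_at_min _ _ (c - e) (c + e)).
    - lra.
    - by move=> h /ballE /He[dh _].
    - by rewrite in_itv /=; lra.
    - by move=> h /ballE /He[].
  have [|dFc _] := He c; first by rewrite subrr normr0.
  by rewrite -(@derive_val _ _ _ _ _ _ _ dFc) (@derive_val _ _ _ _ _ _ _ dc).
split=> //; rewrite leNgt; apply/negP => d2lt0.
have [r /= r0 Hr] : exists2 r, 0 < r & forall k, 0 < k < r -> F1 (c + k) < 0.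
  have quo : k^-1 *: (F1 (k *: 1 + c) - F1 c) @[k --> 0^'] --> d2.
    by have [/[swap] <-] := dF1.
  have := cvgr_lt _ quo _ d2lt0; case=> r /= r0 Hr.
  exists r => // k /andP[k0 kr].
  have := Hr k; rewrite /= sub0r normrN gtr0_norm // => /(_ kr).
  rewrite gt_eqF // => /(_ isT); rewrite F1c subr0 /GRing.scale /= mulr1.
  by rewrite pmulr_rlt0 ?invr_gt0 // addrC.
have [k [k0 ke kr]] : exists k, [/\ 0 < k, k < e & k < r].
  exists (Num.min (e / 2) (r / 2)); rewrite lt_min !divr_gt0 // !gt_min.
  by split=> //; apply/orP; [left|right]; lra.
have dFk h : h \in `[c, c + k] -> is_derive h (1:R) F (F1 h).
  rewrite in_itv /= => /andP[ch hk]; apply: (He h _).1.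
  by rewrite ltr_distlC; lra.
have cck : c < c + k by rewrite ltrDl.
have dF_oo h : h \in `]c, c + k[ -> is_derive h (1:R) F (F1 h).
  by move=> hk; apply: dFk; apply: subset_itv_oo_cc hk.
have F_cts : {within `[c, c + k], continuous F}.
  by apply: derivable_within_continuous => h /dFk dh; exact: ex_derive.
have [z] := MVT cck dF_oo F_cts.
rewrite in_itv /= => /andP[cz zk] E.
have F1z : F1 z < 0.
  by have := Hr (z - c); rewrite subrKC; apply; lra.
have := (He (c + k) _).2; rewrite opprD addrA subrr sub0r normrN gtr0_norm //.
by move=> /(_ ke); nra.
Qed.

(** Reduces directional derivatives of [g] to ordinary derivatives along a
line, to which the one-variable tests apply. *)
Lemma is_derive_line (R : realType) (V : normedModType R) (g : V -> R)
    (p e : V) (h : R) :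
  derivable g (p + h *: e) e ->
  is_derive h (1:R) (fun s => g (p + s *: e)) ('D_e g (p + h *: e)).
Proof.
have E : (fun k : R => k^-1 *: (((fun s => g (p + s *: e)) \o shift h) (k *: 1) -
                            g (p + h *: e))) =
    (fun k : R => k^-1 *: ((g \o shift (p + h *: e)) (k *: e) - g (p + h *: e))).
  apply/funext => k /=; congr (_ *: (g _ - _)).
  by rewrite /GRing.scale /= mulr1 -/(GRing.scale _ _) scalerDl addrCA.
by move=> dg; apply: DeriveDef; rewrite /derivable /derive E.
Qed.

(** * The barrier *)

(** The solutions of g'' - 2 c g' + (c^2 + k^2) g = 0 with g(0) = 1, g'(0) = c:
the factor exp (c s) compensates a drift of speed 2 c. *)
Definition exp_cos (R : realType) (c k s : R) : R :=
  expR (c * s) * cos (k * s).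

Definition exp_cos_deriv (R : realType) (c k s : R) : R :=
  c * exp_cos c k s - k * (expR (c * s) * sin (k * s)).

Lemma is_derive_exp_cos (R : realType) (c k s : R) :
  is_derive s (1:R) (exp_cos c k) (exp_cos_deriv c k s).
Proof.
have -> : exp_cos c k = (expR \o ( *%R c)) * (cos \o ( *%R k)).
  by apply/funext.
apply: is_derive_eq.
rewrite /exp_cos_deriv /exp_cos /GRing.scale /=; ring.
Qed.

Lemma is_derive_exp_cos_deriv (R : realType) (c k s : R) :
  is_derive s (1:R) (exp_cos_deriv c k)
    (2 * c * exp_cos_deriv c k s - (c ^+ 2 + k ^+ 2) * exp_cos c k s).
Proof.
set d := exp_cos_deriv c k s.
have -> : exp_cos_deriv c k =
    c *: exp_cos c k - k *: ((expR \o ( *%R c)) * (sin \o ( *%R k))).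
  by apply/funext.
have := is_derive_exp_cos c k s => ?.
apply: is_derive_eq.
rewrite /d /exp_cos_deriv /exp_cos /GRing.scale /=; ring.
Qed.

Definition barrier (R : realType) (n : nat) (c : 'I_n -> R) (k : R)
    (y : 'rV[R]_n) : R :=
  \prod_(i < n) exp_cos (c i) k (y 0 i).

Lemma barrier_slice (R : realType) (n : nat) (c : 'I_n -> R) (k h : R)
    (y : 'rV[R]_n) (i : 'I_n) :
  barrier c k (y + h *: delta_mx 0 i) =
  (\prod_(j < n | j != i) exp_cos (c j) k (y 0 j)) *
    exp_cos (c i) k (y 0 i + h).
Proof.
rewrite /barrier (bigD1 i) //= mulrC !mxE !eqxx mulr1; congr (_ * _).
by apply: eq_bigr => j ji; rewrite !mxE eqxx (negPf ji) mulr0 addr0.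
Qed.

Lemma continuous_barrier (R : realType) (n : nat) (c : 'I_n -> R) (k : R) :
  continuous (barrier c k).
Proof.
rewrite /barrier; apply: continuous_big => [|i _ y]; first exact: mul_continuous.
apply: (@continuous_comp _ _ _ (fun z : 'rV[R]_n => z 0 i) (exp_cos (c i) k)).
  exact: coord_continuous.
have := is_derive_exp_cos (c i) k (y 0 i) => dg.
by apply/differentiable_continuous/derivable1_diffP.
Qed.

(** Where a barrier touches [m * u] from below, the two functions have the same
derivatives of order one and ordered ones of order two.  The equation solved by
the i-th factor of the barrier expresses its second derivative through its
value and its first derivative, so everything can be rewritten in terms of [u]
alone and the barrier disappears from the conclusion. *)
Lemma barrier_touching_ineq (R : realType) (n : nat) (c : 'I_n -> R) (k m : R)
    (u : 'rV[R]_n -> R) (x y : 'rV[R]_n) (i : 'I_n)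
    (e := delta_mx 0 i : 'rV[R]_n) :
  0 < m ->
  (forall z, derivable u z e) -> derivable (fun z => 'D_e u z) y e ->
  (\forall z \near y, barrier c k (z - x) <= m * u z) ->
  barrier c k (y - x) = m * u y ->
  2 * c i * 'D_e u y - (c i ^+ 2 + k ^+ 2) * u y <=
    'D_e (fun z => 'D_e u z) y.
Proof.
move=> m0 du ddu le_mu eq_mu.
pose P := \prod_(j < n | j != i) exp_cos (c j) k ((y - x) 0 j).
pose s := (y - x) 0 i.
have sliceE h : barrier c k (y + h *: e - x) = P * exp_cos (c i) k (s + h).
  by rewrite addrAC barrier_slice.
pose F h := m * u (y + h *: e) - P * exp_cos (c i) k (s + h).
pose F1 h := m * 'D_e u (y + h *: e) - P * exp_cos_deriv (c i) k (s + h).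
have y0 : y + 0 *: e = y by rewrite scale0r addr0.
have dsh h : is_derive h (1:R) (fun t : R => s + t) 1.
  have := is_derive_shift h 1 s; rewrite (_ : shift s = (fun t => s + t)) //.
  by apply/funext => t; rewrite /= addrC.
have dF h : is_derive h (1:R) F (F1 h).
  have dl := @is_derive_line _ _ u y e h (du _).
  have dg := is_derive_exp_cos (c i) k (s + h).
  have -> : F = m *: (fun t => u (y + t *: e)) -
                P *: (exp_cos (c i) k \o (fun t => s + t)) by apply/funext.
  by apply: is_derive_eq; rewrite /F1 /GRing.scale /= mulr1.
have dF1 : is_derive (0 : R) (1:R) F1
    (m * 'D_e (fun z => 'D_e u z) y -
     P * (2 * c i * exp_cos_deriv (c i) k s -
          (c i ^+ 2 + k ^+ 2) * exp_cos (c i) k s)).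
  have := @is_derive_line _ _ (fun z => 'D_e u z) y e 0; rewrite y0 => /(_ ddu) dl.
  have dg := is_derive_exp_cos_deriv (c i) k (s + 0).
  have -> : F1 = m *: (fun t => 'D_e u (y + t *: e)) -
                P *: (exp_cos_deriv (c i) k \o (fun t => s + t)) by apply/funext.
  by apply: is_derive_eq; rewrite addr0 /GRing.scale /= mulr1.
have E0 : P * exp_cos (c i) k s = m * u y.
  by rewrite -eq_mu -[in RHS]y0 sliceE addr0.
have minF : \forall h \near (0 : R), F 0 <= F h.
  have line_cts : (fun h : R => y + h *: e) @ (0 : R) --> y.
    rewrite -[X in _ --> X]y0; apply: cvgD; first exact: cvg_cst.
    by apply: cvgZr_tmp.
  have near_le : \forall h \near (0 : R),
      barrier c k (y + h *: e - x) <= m * u (y + h *: e) := line_cts _ le_mu.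
  apply: filterS near_le => h.
  by rewrite sliceE /F y0 addr0 E0 subrr subr_ge0.
have near_dF : \forall h \near (0 : R), is_derive h (1:R) F (F1 h).
  apply: filterE => h; exact: dF.
have [] := second_derivative_test near_dF dF1 minF.
rewrite /F1 y0 addr0 => /subr0_eq E1 d2_ge0.
rewrite -subr_ge0 -(pmulr_rge0 _ m0); move: d2_ge0.
suff -> : P * (2 * c i * exp_cos_deriv (c i) k s -
               (c i ^+ 2 + k ^+ 2) * exp_cos (c i) k s) =
          m * (2 * c i * 'D_e u y - (c i ^+ 2 + k ^+ 2) * u y).
  by move=> d2_ge0; rewrite mulrBr.
rewrite mulrBr mulrCA -E1 [P * (_ * _)]mulrCA E0; ring.
Qed.

(** * Lower bound for the profile and for the speed *)

(** A positive profile of subcritical speed is uniformly positive: the height at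
which the barrier centred at [x] touches [u] does not depend on [x]. *)
Lemma stationary_lower_bound (R : realType) (n : nat) (a b eta : R)
    (u : 'rV[R]_n.+1 -> R) :
  0 < b -> eta ^+ 2 < 4 * a ->
  (forall y, 0 < u y) -> continuous u ->
  (forall i y, derivable u y (basis_vector R i)) ->
  (forall i y, derivable (fun z => 'D_(basis_vector R i) u z) y
                 (basis_vector R i)) ->
  (forall y, eta * 'D_(basis_vector R ord_max) u y =
     \sum_(i < n.+1) 'D_(basis_vector R i)
                        (fun z => 'D_(basis_vector R i) u z) y
     + a * u y - b * u y ^+ 3) ->
  exists2 d, 0 < d & forall x, d <= u x.
Proof.
move=> b0 eta_lt u0 u_cts du ddu u_eq.
pose N : R := n.+1%:R.
have N0 : 0 < N by rewrite ltr0n.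
pose mu := a - eta ^+ 2 / 4.
have mu0 : 0 < mu by rewrite /mu; lra.
(* Each of the N factors cos (k x_i) costs k^2, half of mu in total; the other
   half is what the cubic term has to balance at the touching point. *)
pose k := Num.sqrt (mu / (2 * N)).
have k0 : 0 < k by rewrite sqrtr_gt0 divr_gt0 // mulr_gt0.
have Nk2 : N * k ^+ 2 = mu / 2.
  rewrite sqr_sqrtr ?divr_ge0 ?mulr_ge0 ?(ltW mu0) ?(ltW N0) //.
  by field; rewrite gt_eqF.
(* The drift acts on the last coordinate only. *)
pose c (i : 'I_n.+1) : R := if i == ord_max then eta / 2 else 0.
pose rho := pi / 2 / k.
have krho : k * rho = pi / 2 by rewrite /rho mulrC divfK // gt_eqF.
have rho0 : 0 < rho by rewrite !divr_gt0 // pi_gt0.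
pose M := \prod_(i < n.+1) expR (`|c i| * rho).
have M0 : 0 < M by apply: prodr_gt0 => i _; exact: expR_gt0.
exists (Num.sqrt (mu / (2 * b)) / M).
  by rewrite divr_gt0 // sqrtr_gt0 divr_gt0 // mulr_gt0.
move=> x.
pose box := [set y : 'rV[R]_n.+1 |
  forall i, `[x 0 i - rho, x 0 i + rho]%classic (y 0 i)].
have boxP y i : box y -> `|y 0 i - x 0 i| <= rho.
  by move=> /(_ i); rewrite /= in_itv /= ler_distl.
have cos_ge0 y i : box y -> 0 <= cos (k * (y - x) 0 i).
  move=> /(@boxP y i); rewrite !mxE ler_norml => /andP[l r].
  by apply: cos_ge0_pihalf; rewrite -krho -mulrN !ler_pM2l // l r.
have box_cpt : compact box.
  have side_cpt i : compact `[x 0 i - rho, x 0 i + rho]%classic.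
    exact: segment_compact.
  exact: (rV_compact side_cpt).
have box_x : box x by move=> i; rewrite /= in_itv /=; lra.
pose w (y : 'rV[R]_n.+1) := barrier c k (y - x) / u y.
have bar_cts : continuous (fun y : 'rV[R]_n.+1 => barrier c k (y - x)).
  move=> y; apply: (@continuous_comp _ _ _ (fun z : 'rV[R]_n.+1 => z - x) (barrier c k)).
    by apply: (@continuousB _ _ _ id (cst x)) => //; exact: cst_continuous.
  exact: continuous_barrier.
have w_cts : continuous w.
  move=> y.
  exact: continuousM (bar_cts y) (continuousV (lt0r_neq0 (u0 y)) (u_cts y)).
have [y] : exists2 y, y \in box & forall z, z \in box -> w z <= w y.
  apply: EVT_max_rV => //; first by exists x.
  exact: continuous_subspaceT.
rewrite inE => box_y w_max.
pose m := w y.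
have bar0 : barrier c k (x - x) = 1.
  rewrite subrr /barrier big1 // => i _.
  by rewrite mxE /exp_cos !mulr0 expR0 cos0 mulr1.
have ux_m : (u x)^-1 <= m.
  by have := w_max x; rewrite inE => /(_ box_x); rewrite {1}/w bar0 mul1r.
have m0 : 0 < m by apply: lt_le_trans ux_m; rewrite invr_gt0.
have bar_y : barrier c k (y - x) = m * u y by rewrite /m /w divfK // gt_eqF.
have bar_y0 : barrier c k (y - x) != 0 by rewrite bar_y gt_eqF // mulr_gt0.
(* On a face of the box one cosine vanishes, which a maximum point of w, where
   w is positive, excludes. *)
have inner i : `|y 0 i - x 0 i| < rho.
  rewrite lt_neqAle boxP // andbT; apply: contra bar_y0 => /eqP E.
  apply/eqP; rewrite /barrier (bigD1 i) //= /exp_cos !mxE.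
  have -> : cos (k * (y 0 i - x 0 i)) = 0.
    have <- : cos (k * `|y 0 i - x 0 i|) = cos (k * (y 0 i - x 0 i)).
      by case: ger0P => _ //; rewrite mulrN cosN.
    by rewrite E krho cos_pihalf.
  by rewrite mulr0 mul0r.
have le_bar : \forall z \near y, barrier c k (z - x) <= m * u z.
  have near_box : \forall z \near y,
      (fun z : 'rV[R]_n.+1 => forall i, `|z 0 i - x 0 i| < rho) z.
    apply: (filter_forall (F := nbhs y)
      (f := fun i (z : 'rV[R]_n.+1) => `|z 0 i - x 0 i| < rho)) => i.
    have cts : {for y, continuous (fun z : 'rV[R]_n.+1 => `|z 0 i - x 0 i|)}.
      apply: continuous_comp; last exact: norm_continuous.
      apply: (@continuousB _ _ _ (fun z : 'rV[R]_n.+1 => z 0 i) (cst (x 0 i))).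
        exact: coord_continuous.
      exact: cst_continuous.
    exact: (cvgr_lt _ cts _ (inner i)).
  apply: filterS near_box => z z_in; rewrite -ler_pdivrMr //.
  by apply: w_max; rewrite inE => i /=; rewrite in_itv /= -ler_distl ltW.
have sum_ineq : eta * 'D_(basis_vector R ord_max) u y
    - (eta ^+ 2 / 4 + N * k ^+ 2) * u y <=
    \sum_(i < n.+1) 'D_(basis_vector R i)
                        (fun z => 'D_(basis_vector R i) u z) y.
  have touch i := barrier_touching_ineq m0 (du i) (ddu i y) le_bar bar_y.
  apply: le_trans (ler_sum _ (fun i _ => touch i)).
  rewrite big_split /= sumrN -mulr_suml big_split /= sumr_const card_ord.
  rewrite -[k ^+ 2 *+ _]mulr_natl -/N.
  rewrite (bigD1 ord_max) //= big1 => [|i /negPf ni]; last first.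
    by rewrite /c ni mulr0 mul0r.
  rewrite (bigD1 ord_max) //= big1 => [|i /negPf ni]; last first.
    by rewrite /c ni expr0n.
  by rewrite /c eqxx !addr0 /basis_vector; lra.
have uy_ge : mu / (2 * b) <= u y ^+ 2.
  have eliminate (p q s : R) : 0 < s ->
      eta * p - (eta ^+ 2 / 4 + mu / 2) * s <= q ->
      eta * p = q + a * s - b * s ^+ 3 -> mu / (2 * b) <= s ^+ 2.
    move=> s0 le_q eq_q; rewrite ler_pdivrMr ?mulr_gt0 // -(ler_pM2r s0).
    by move: le_q eq_q; rewrite /mu; lra.
  by rewrite Nk2 in sum_ineq; exact: eliminate (u0 y) sum_ineq (u_eq y).
have bar_le : barrier c k (y - x) <= M.
  apply: ler_prod => i _; rewrite /exp_cos mulr_ge0 ?expR_ge0 ?cos_ge0 //=.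
  rewrite -[leRHS]mulr1 ler_pM ?expR_ge0 ?cos_ge0 ?cos_le1 //.
  rewrite ler_expR (le_trans (ler_norm _)) // normrM ler_wpM2l //.
  by rewrite !mxE boxP.
have uxy : u y <= M * u x.
  rewrite -ler_pdivrMr //.
  apply: (@le_trans _ _ (m * u y)); last by rewrite -bar_y.
  by rewrite mulrC ler_pM2r.
rewrite ler_pdivrMr // [u x * M]mulrC; apply: le_trans uxy.
by rewrite -[leRHS](ger0_norm (ltW (u0 y))) -sqrtr_sqr ler_wsqrtr.
Qed.

(** The profile is taken at time 1 rather than 0, because the equation is only
known at positive times; the time derivative there becomes [eta] times a space
derivative by following the wave along its direction of propagation. *)
Lemma wavespeed_lower_bound (R : realType) (n : nat) (a b : R)
    (f : 'rV[R]_n.+1 * R -> R) (v : 'rV[R]_n.+1 -> R) (eta : R) :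
  0 < b -> newell_whitehead_solution a b f ->
  (forall (x : 'rV[R]_n.+1) (t : R), 0 <= t -> 0 < f (x, t)) ->
  traveling_wave f v eta ->
  (exists z : nat -> 'rV[R]_n.+1, v (z k) @[k --> \oo] --> 0) ->
  4 * a <= eta ^+ 2.
Proof.
move=> b0 [f_cts fC21 f_eq] f0 f_wave [z vz].
rewrite leNgt; apply/negP => eta_lt.
pose e := basis_vector R (@ord_max n).
pose u y := f (y, 1).
have du i y : derivable u y (basis_vector R i).
  have [_ dx _] := fC21 (y, 1) ltr01; exact: (dx i).1.
have ddu i y : derivable (fun z => 'D_(basis_vector R i) u z) y
                 (basis_vector R i).
  have [_ _ dxx] := fC21 (y, 1) ltr01; exact: (dxx i i).1.
(* [f] is only continuous within t >= 0, but t = 1 is interior to that set. *)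
have u_cts : continuous u.
  move=> y.
  have nb : nbhs (y, 1 : R) [set p : 'rV[R]_n.+1 * R | 0 <= p.2].
    have : (fun p : 'rV[R]_n.+1 * R => p.2) @ (y, 1 : R) --> (1 : R).
      exact: cvg_snd.
    by move=> /cvgr_ge /(_ 0 ltr01).
  have fy : {for (y, 1), continuous f}.
    have := f_cts (y, 1); rewrite /prop_for /continuous_at.
    by rewrite -(nbhs_subspace_interior nb).
  have pair_cts : {for y, continuous (fun x : 'rV[R]_n.+1 => (x, 1 : R))}.
    exact: cvg_pair (@cvg_id _ (nbhs y)) (cvg_cst (1 : R)).
  exact: continuous_comp pair_cts fy.
have f_line y s : 0 <= s -> f (y, s) = u (y + (eta * (s - 1)) *: e).
  move=> s0; rewrite /u !f_wave ?ler01 // -addrA -scalerDl.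
  by congr (v (_ + _ *: _)); ring.
have ft y : partial_t f (y, 1) = eta * 'D_e u y.
  have near1 : \forall s \near (1 : R), f (y, s) = u (y + (eta * (s - 1)) *: e).
    by near=> s; apply: f_line; apply: ltW; near: s; exact: lt_nbhsr.
  rewrite /partial_t derive1E (near_eq_derive _ near1) /=.
  have := @is_derive_line _ _ u y e 0 (du _ _).
  rewrite scale0r addr0 => dl.
  have dt : is_derive (1 : R) (1 : R) (fun s : R => eta * (s - 1)) eta.
    have -> : (fun s : R => eta * (s - 1)) = eta *: (id - cst 1) by [].
    by apply: is_derive_eq; rewrite subr0 /GRing.scale /= mulr1.
  have dcomp : is_derive (1 : R) (1 : R)
      ((fun t => u (y + t *: e)) \o (fun s => eta * (s - 1))) (eta * 'D_e u y).
    rewrite mulrC; apply: is_derive1_comp.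
    by rewrite subrr mulr0.
  exact: derive_val.
have [d d0 Hd] : exists2 d, 0 < d & forall x, d <= u x.
  apply: (stationary_lower_bound b0 eta_lt) => // [y|y].
    exact: f0.
  by rewrite -ft f_eq.
have := cvgr_lt _ vz _ d0.
case=> K _ /(_ K (leqnn _)) /=; rewrite ltNge => /negP; apply.
have := Hd (z K - eta *: e); rewrite /u f_wave // mulr1 subrK.
by [].
Unshelve. all: by end_near.
Qed.

Theorem corollary4p2 (R : realType) (n : nat) (a b : R)
    (f : 'rV[R]_n.+1 * R -> R) (v : 'rV[R]_n.+1 -> R) (eta : R)
    (a_gt0 : 0 < a) (b_gt0 : 0 < b)
    (f_sol : newell_whitehead_solution a b f)
    (f_gt0 : forall (x : 'rV[R]_n.+1) (t : R), 0 <= t -> 0 < f (x, t))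
    (f_wave : traveling_wave f v eta)
    (v_to0 : exists z : nat -> 'rV[R]_n.+1,
       euclidean_norm (z k) @[k --> \oo] --> +oo /\
       v (z k) @[k --> \oo] --> 0) :
  4 / 3 * a <= eta ^+ 2.
Proof.
have [z [_ vz]] := v_to0.
have := wavespeed_lower_bound b_gt0 f_sol f_gt0 f_wave (ex_intro _ z vz).
lra.
Qed.
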